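(* Let $X=\bigcup_{i=1}^\infty(2^i\mathbb{Z})^i$ (disjoint union over $i$) be equipped with the following metric $d$: for $a=(a_1,\dots,a_l)\in(2^l\mathbb{Z})^l$ and $b=(b_1,\dots,b_k)\in(2^k\mathbb{Z})^k$ with $l\le k$, put $a'=(a_1,\dots,a_l,0,\dots,0)\in\mathbb{Z}^k$, put $c=0$ if $l=k$ and $c=l+(l+1)+\dots+(k-1)$ if $l<k$, and set $d(a,b)=\max\{d_{\max}(a',b),c\}$, where $d_{\max}$ is the maximum metric on $\mathbb{Z}^k$. Equip $X\times X$ with the metric $d_{X\times X}((x,y),(x',y'))=\max\{d(x,x'),d(y,y')\}$. Then $\operatorname{trasdim}(X\times X)=\omega$.
   Context: Here $j\mathbb{Z}=\{jt:t\in\mathbb{Z}\}$. For subsets $U,V$ of a metric space $(X,d)$, $\operatorname{diam}U=\sup\{d(x,y):x,y\in U\}$ and $d(U,V)=\inf\{d(x,y):x\in U,y\in V\}$. A family $\mathcal{U}$ of subsets is uniformly bounded if there is $R>0$ with $\operatorname{diam}U\le R$ for all $U\in\mathcal{U}$, and $r$-disjoint if $d(U,V)\ge r$ for all $U\ne V$ in $\mathcal{U}$. Transfinite asymptotic dimension: let $Fin\,\mathbb{N}$ be the collection of finite nonempty subsets of $\mathbb{N}$. For $M\subseteq Fin\,\mathbb{N}$ and $a\in\mathbb{N}$ let $M^a=\{\tau\in Fin\,\mathbb{N}:\tau\cup\{a\}\in M,\ a\notin\tau\}$. Define inductively: $\operatorname{Ord}M=0$ iff $M=\varnothing$; $\operatorname{Ord}M\le\alpha$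 iff $\operatorname{Ord}M^a<\alpha$ for all $a\in\mathbb{N}$ (for ordinals $\alpha>0$); $\operatorname{Ord}M=\alpha$ iff $\operatorname{Ord}M\le\alpha$ and not $\operatorname{Ord}M<\alpha$; $\operatorname{Ord}M=\infty$ iff $\operatorname{Ord}M\le\alpha$ for no ordinal $\alpha$. For a metric space $(X,d)$ let $A(X,d)$ be the set of all $\sigma\in Fin\,\mathbb{N}$ such that there are no uniformly bounded families $\mathcal{U}_i$ $(i\in\sigma)$ of subsets of $X$ with each $\mathcal{U}_i$ $i$-disjoint and $\bigcup_{i\in\sigma}\mathcal{U}_i$ covering $X$. Then $\operatorname{trasdim}X=\operatorname{Ord}A(X,d)$. *)

(* Defs.v *)
From HB Require Import structures.
From mathcomp Require Import all_boot all_order all_algebra finmap.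
From mathcomp Require Import all_classical all_reals all_analysis.

Set Implicit Arguments.
Unset Strict Implicit.
Unset Printing Implicit Defensive.

Import Order.TTheory GRing.Theory Num.Theory.

Local Open Scope classical_set_scope.
Local Open Scope ring_scope.

(* An ordinal is given by a well-founded tree: [osup f] denotes the least
   ordinal strictly above every [f i]. Two trees denote the same ordinal when
   each is [ole] the other. *)
Inductive ord_num : Type := osup (J : Type) (f : J -> ord_num).

Fixpoint ole (x y : ord_num) {struct x} : Prop :=
  match x, y with
  | osup J f, osup K g => forall i : J, exists j : K, ole (f i) (g j)
  end.

Definition olt (x y : ord_num) : Prop :=
  match y with osup K g => exists j : K, ole x (g j) end.

Definition ozero : ord_num := osup (fun e : Empty_set => match e with end).

Definition osucc (x : ord_num) : ord_num := osup (fun _ : unit => x).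

Definition onat (n : nat) : ord_num := iter n osucc ozero.

Definition omega : ord_num := osup onat.

Lemma ole_refl x : ole x x.
Proof. by elim: x => J f IH /= i; exists i; exact: IH. Qed.

Lemma ole_trans y x z : ole x y -> ole y z -> ole x z.
Proof.
elim: y x z => J g IH [I f] [K h] fg gh i.
have [j /IH{}fg] := fg i; have [k gk] := gh j.
by exists k; exact: fg.
Qed.

Lemma olt_ole_trans y x z : olt x y -> ole y z -> olt x z.
Proof.
case: y z => J g [K h] [j xj] /(_ j)[k jk].
by exists k; exact: ole_trans jk.
Qed.

(* [FinN] is taken over all of [nat]. The element 0 plays no role for [trasdim]:
   a set containing 0 never lies in [asdim_obstr] below, since singletons cover
   the space and every family is 0-disjoint. *)
Definition FinN : set {fset nat} := [set s | s != fset0].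

Definition derived (M : set {fset nat}) (a : nat) : set {fset nat} :=
  [set t | FinN t /\ M (a |` t)%fset /\ a \notin t].

(* [Ord_le M x] is "Ord M <= x" by recursion on x; for x = osup f, "Ord N < x"
   amounts to "Ord N <= f i for some i". [Ord_leP] is the recursion in terms of
   the order on ordinals. *)
Fixpoint Ord_le (M : set {fset nat}) (x : ord_num) {struct x} : Prop :=
  match x with
  | osup J f => (~ inhabited J /\ M = set0) \/
      (inhabited J /\ forall a : nat, exists i : J, Ord_le (derived M a) (f i))
  end.

Definition Ord_lt (M : set {fset nat}) (x : ord_num) : Prop :=
  exists y, olt y x /\ Ord_le M y.

Definition Ord_eq (M : set {fset nat}) (x : ord_num) : Prop :=
  Ord_le M x /\ ~ Ord_lt M x.

Lemma derived0 a : derived set0 a = set0.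
Proof. by apply/seteqP; split=> // t [_ []]. Qed.

Lemma Ord_le_set0 x : Ord_le set0 x.
Proof.
elim: x => J f IH /=; have [nI|nI] := pselect (inhabited J); last by left.
by right; split=> // a; case: nI => i; exists i; rewrite derived0.
Qed.

Lemma Ord_le_mono x y M : ole x y -> Ord_le M x -> Ord_le M y.
Proof.
elim: x y M => J f IH [K g] M fg [[nI ->]|[[i0] fM]]; first exact: Ord_le_set0.
right; split; first by have [j _] := fg i0; exists.
move=> a; have [i iM] := fM a; have [j ij] := fg i.
by exists j; exact: IH iM.
Qed.

Lemma Ord_leP M x : Ord_le M x <->
  (ole x ozero /\ M = set0) \/ (olt ozero x /\ forall a, Ord_lt (derived M a) x).
Proof.
case: x => J f; split.
  move=> [[nI M0]|[[i0] fM]]; [left|right].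
    by split=> // i; case: nI; exists.
  split; first by exists i0; case: (f i0) => ? ? [].
  by move=> a; have [i iM] := fM a; exists (f i); split=> //; exists i; exact: ole_refl.
move=> [[f0 M0]|[[i0 _] fM]]; [left|right].
  by split=> // -[i]; have [] := f0 i.
split; first by exists.
by move=> a; have [y [[i yi] yM]] := fM a; exists i; exact: Ord_le_mono yM.
Qed.

Section trasdim.
Context {R : realType} {T : metricType R}.
Implicit Types (A B : set T) (U : set (set T)).

(* diam set0 = -oo, and set_dist A B = +oo when A or B is empty, so the empty
   set constrains neither of the two predicates below. *)
Definition diam A : \bar R :=
  ereal_sup [set (mdist z.1 z.2)%:E | z in A `*` A].

Definition set_dist A B : \bar R :=
  ereal_inf [set (mdist z.1 z.2)%:E | z in A `*` B].

Definition uniformly_bounded U : Prop :=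
  exists2 r : R, 0 < r & forall A, U A -> (diam A <= r%:E)%E.

Definition disjoint_at (r : R) U : Prop :=
  forall A B, U A -> U B -> A <> B -> (r%:E <= set_dist A B)%E.

End trasdim.

Definition asdim_obstr {R : realType} (T : metricType R) : set {fset nat} :=
  [set s | FinN s /\ ~ exists U : nat -> set (set T),
    (forall i, i \in s -> uniformly_bounded (U i) /\ disjoint_at i%:R (U i)) /\
    \bigcup_(A in \bigcup_(i in [set` s]) U i) A = setT].

Definition trasdim_eq {R : realType} (T : metricType R) (x : ord_num) : Prop :=
  Ord_eq (asdim_obstr T) x.

Section prod_metric.
Context {R : realType} (T1 T2 : metricType R).

Definition prod_mdist (x y : T1 * T2) : R :=
  Num.max (mdist x.1 y.1) (mdist x.2 y.2).

Lemma prod_mdist_ge0 x y : 0 <= prod_mdist x y.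
Proof. by rewrite /prod_mdist le_max mdist_ge0. Qed.

Lemma prod_mdist_positivity x y : prod_mdist x y = 0 -> x = y.
Proof.
case: x y => [x1 x2] [y1 y2] /= xy0; congr pair; apply: mdist_positivity;
  apply/eqP; rewrite eq_le mdist_ge0 andbT -xy0 /prod_mdist le_max lexx //=.
by rewrite orbT.
Qed.

Lemma prod_ballEmdist x e : ball x e = [set y | prod_mdist x y < e].
Proof.
apply/seteqP; split=> y; rewrite /prod_mdist /= gt_max.
  by move=> [] /=; rewrite !ballEmdist /= => -> ->.
by move=> /andP[? ?]; split; rewrite ballEmdist.
Qed.

HB.instance Definition _ := PseudoMetric_isMetric.Build R (T1 * T2)%type
  prod_mdist_ge0 prod_mdist_positivity prod_ballEmdist.

End prod_metric.

(* (2^i Z)^i, with jZ given as the multiples of j in int. *)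
Definition layer (i : nat) : Type :=
  {t : i.-tuple int | all (fun z => ((2 ^ i)%N %| z)%Z) t}.

HB.instance Definition _ i := Choice.on (layer i).

(* The disjoint union over i >= 1: tag i carries the layer of index i.+1. The
   parameter R only records the field in which the metric takes its values. *)
Definition Xspace (R : realType) : Type := {i : nat & layer i.+1}.

HB.instance Definition _ (R : realType) := Choice.on (Xspace R).

Section Xspace_metric.
Context {R : realType}.
Implicit Types x y z : Xspace R.

Definition Xlen x : nat := (tag x).+1.

Definition Xcoord x : seq int := val (val (tagged x)).

Definition pad0 (k : nat) (s : seq int) : seq int := s ++ nseq (k - size s) 0.

Definition dmax (k : nat) (s t : seq int) : nat :=
  \max_(m < k) absz (s`_m - t`_m)%R.

Definition Xdist_le x y : nat :=
  maxn (dmax (Xlen y) (pad0 (Xlen y) (Xcoord x)) (Xcoord y))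
       (\sum_(Xlen x <= j < Xlen y) j)%N.

Definition Xdist x y : nat :=
  if (Xlen x <= Xlen y)%N then Xdist_le x y else Xdist_le y x.

Lemma size_Xcoord x : size (Xcoord x) = Xlen x.
Proof. by rewrite /Xcoord size_tuple. Qed.

Lemma nth_pad0 k s m : (pad0 k s)`_m = s`_m.
Proof.
rewrite /pad0 nth_cat; case: ltnP => // sm.
by rewrite nth_nseq if_same nth_default.
Qed.

Lemma Xdist_leP x y n : (Xlen x <= Xlen y)%N ->
  reflect ((forall m, absz ((Xcoord x)`_m - (Xcoord y)`_m)%R <= n)%N /\
           (\sum_(Xlen x <= j < Xlen y) j <= n)%N) (Xdist_le x y <= n)%N.
Proof.
move=> lxy; rewrite /Xdist_le geq_max; apply: (iffP andP) => -[dn cn]; split=> //.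
  move=> m; have [my|ym] := ltnP m (Xlen y); last first.
    by rewrite !nth_default ?size_Xcoord // (leq_trans lxy).
  move/bigmax_leqP: dn => /(_ (Ordinal my) isT) /=.
  by rewrite nth_pad0.
by apply/bigmax_leqP => m _; rewrite nth_pad0.
Qed.

Definition tri (n : nat) : nat := (\sum_(0 <= j < n) j)%N.

Lemma triB l k : (l <= k)%N -> (\sum_(l <= j < k) j + tri l = tri k)%N.
Proof. by move=> lk; rewrite addnC /tri -big_cat_nat. Qed.

Lemma tri_homo l k : (l <= k)%N -> (tri l <= tri k)%N.
Proof. by move=> /triB <-; exact: leq_addl. Qed.

Lemma XdistP x y n : reflect
  [/\ forall m, (absz ((Xcoord x)`_m - (Xcoord y)`_m)%R <= n)%N,
      (tri (Xlen x) <= n + tri (Xlen y))%N &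
      (tri (Xlen y) <= n + tri (Xlen x))%N] (Xdist x y <= n)%N.
Proof.
have absC (a b : int) : absz (a - b) = absz (b - a) by rewrite -abszN opprB.
rewrite /Xdist; case: (leqP (Xlen x) (Xlen y)) => [xy|/ltnW xy];
  apply: (iffP (Xdist_leP n xy)).
- move=> [dn cn]; split=> //; last by rewrite -(triB xy) leq_add2r.
  by rewrite (leq_trans (tri_homo xy)) ?leq_addl.
- by move=> [dn _ +]; rewrite -(triB xy) leq_add2r.
- move=> [dn cn]; split=> [m||]; first by rewrite absC.
    by rewrite -(triB xy) leq_add2r.
  by rewrite (leq_trans (tri_homo xy)) ?leq_addl.
- move=> [dn + _]; rewrite -(triB xy) leq_add2r; split=> // m.
  by rewrite absC.
Qed.

Lemma Xdistxx x : Xdist x x = 0%N.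
Proof.
apply/eqP; rewrite -leqn0; apply/XdistP; split=> // m.
by rewrite subrr.
Qed.

Lemma Xdist_sym x y : Xdist x y = Xdist y x.
Proof.
have absC (a b : int) : absz (a - b) = absz (b - a) by rewrite -abszN opprB.
apply/eqP; rewrite eqn_leq; apply/andP; split; apply/XdistP;
  [have /XdistP[d1 d2 d3] := leqnn (Xdist y x)|
   have /XdistP[d1 d2 d3] := leqnn (Xdist x y)];
  by split=> // m; rewrite absC.
Qed.

Lemma Xdist_triangle y x z : (Xdist x z <= Xdist x y + Xdist y z)%N.
Proof.
have /XdistP[a1 a2 a3] := leqnn (Xdist x y).
have /XdistP[b1 b2 b3] := leqnn (Xdist y z).
apply/XdistP; split.
- move=> m; have -> : (Xcoord x)`_m - (Xcoord z)`_m =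
    ((Xcoord x)`_m - (Xcoord y)`_m) + ((Xcoord y)`_m - (Xcoord z)`_m).
    by rewrite addrA subrK.
  rewrite (leq_trans _ (leq_add (a1 m) (b1 m))) // -lez_nat PoszD !abszE.
  exact: ler_normD.
- by rewrite (leq_trans a2) // -addnA leq_add2l.
- by rewrite (leq_trans b3) // [(_ + Xdist y z)%N]addnC -addnA leq_add2l.
Qed.

Lemma Xdist_eq0 x y : Xdist x y = 0%N -> x = y.
Proof.
move=> xy0; have /XdistP[d c1 c2] : (Xdist x y <= 0)%N by rewrite xy0.
have lt_tri i j : (i < j)%N -> (tri i.+1 < tri j.+1)%N.
  move=> ij; apply: (@leq_trans (tri i.+2)); last exact: tri_homo.
  by rewrite /tri [in ltnRHS]big_nat_recr //= -ltn_subLR // subnn.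
case: x y d c1 c2 {xy0} => [i s] [j t] d; rewrite !add0n /Xlen /= => c1 c2.
have eij : i = j.
  case: (ltngtP i j) => // /lt_tri; first by rewrite ltnNge c2.
  by rewrite ltnNge c1.
rewrite -{}eij in t d *; congr existT; apply/val_inj/val_inj.
apply: (@eq_from_nth _ 0); rewrite ?size_tuple // => m _.
by apply/eqP; rewrite -subr_eq0 -absz_eq0 -leqn0; exact: d.
Qed.

Definition Xmdist x y : R := (Xdist x y)%:R.

Lemma Xmdistxx x : Xmdist x x = 0.
Proof. by rewrite /Xmdist Xdistxx. Qed.

Lemma Xmdist_positivity x y : Xmdist x y = 0 -> x = y.
Proof. by move/eqP; rewrite pnatr_eq0 => /eqP/Xdist_eq0. Qed.

Lemma Xmdist_sym x y : Xmdist x y = Xmdist y x.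
Proof. by rewrite /Xmdist Xdist_sym. Qed.

Lemma Xmdist_triangle y x z : Xmdist x z <= Xmdist x y + Xmdist y z.
Proof. by rewrite /Xmdist -natrD ler_nat Xdist_triangle. Qed.

End Xspace_metric.

HB.instance Definition _ (R : realType) := isMetric.Build R (Xspace R)
  (@Xmdistxx R) (@Xmdist_positivity R) (@Xmdist_sym R) (@Xmdist_triangle R).

(* Main.v *)
(* Lower bound.  [X * X] contains a copy of [2^n Z^n] for every [n], on which
   [n] families that are [r]-disjoint for some [r > 2^n] would give a colouring
   [col] of Z^n with [n] colours and a map [q] at bounded distance from the
   identity, such that neighbours of the same colour have the same image under
   [q].  Triangulate Z^n by the simplices
   [x, x + e_(i1), x + e_(i1) + e_(i2), ...]: the signed volume swept by the
   functions [t < q_k] equals that of the functions [t < x_k], which is [n!], as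
   the two agree far out (Stokes); but each simplex has two vertices of the same
   colour, so it contributes 0.

   Upper bound.  Given [a], call a point long if its layer has index > [a], and
   short otherwise.  Distinct points are at distance >= [a] as soon as one of
   them is long, so singletons cover the pairs of long points, and short pairs
   lie in a space of finite asymptotic dimension.  For [x] short and [y] long,
   the [a]-disjoint family consists of the sets [box * {y}] where the boxes
   avoid slabs whose position depends on a colour of [y].  The slabs of
   different colours being [r]-apart, what is left needs a number of
   [r]-disjoint families that depends on [a] only. *)
Require Import Defs.
From HB Require Import structures.
From mathcomp Require Import all_boot all_order all_algebra finmap.
From mathcomp Require Import all_classical all_reals all_analysis.
From mathcomp Require Import perm zify ring.

Set Implicit Arguments.
Unset Strict Implicit.
Unset Printing Implicit Defensive.

Import Order.TTheory GRing.Theory Num.Theory.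

Local Open Scope classical_set_scope.
Local Open Scope ring_scope.

(** * The volume of a bounded perturbation of Z^n *)

Section KuhnCells.
Variable p : nat.
Local Notation pt := {ffun 'I_p.+1 -> nat}.
Implicit Types (F : 'I_p.+1 -> pt -> int) (s : 'S_p.+1) (x : pt).

(* [s c] is the step at which the path through the vertices of the simplex
   increments the coordinate [c]. *)
Definition vertex x s (j : 'I_p.+2) : pt := [ffun c => (x c + (s c < j))%N].

(** For [n = p.+2] the determinant is [(p.+1)!] times the signed volume of the simplex spanned by
    the images under [F]; facets use [n = p.+1]. *)
Definition affine_mx n F (u : 'I_n -> pt) : 'M[int]_(p.+2, n) :=
  \matrix_(k, i) oapp (F^~ (u i)) 1 (unlift ord0 k).

Definition cell_vol F x s : int := \det (affine_mx F (vertex x s)).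

Definition boxpt m (y : {ffun 'I_p.+1 -> 'I_m.+1}) : pt :=
  [ffun c => val (y c)].

(** The cells [(y, s)] form the Kuhn triangulation of the cube [0, m + 1]^(p + 1), and [(-1) ^+ s]
    orients them alike. *)
Definition total_vol m F : int :=
  \sum_(y : {ffun 'I_p.+1 -> 'I_m.+1}) \sum_(s : 'S_p.+1)
    (-1) ^+ s * cell_vol F (boxpt y) s.

(* Summing [F k0] over all vertices makes the form depend on the facet only, so
   that the contributions of two cells sharing a facet cancel. *)
Definition facet_form F (k0 : 'I_p.+1) (u : 'I_p.+1 -> pt) : int :=
  (\sum_i F k0 (u i)) * \det (row' (lift ord0 k0) (affine_mx F u)).

Lemma eq_affine_mx n F (u v : 'I_n -> pt) :
  u =1 v -> affine_mx F u = affine_mx F v.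
Proof. by move=> uv; apply/matrixP => k i; rewrite !mxE uv. Qed.

Lemma eq_facet_form F k0 u v : u =1 v -> facet_form F k0 u = facet_form F k0 v.
Proof.
move=> uv; rewrite /facet_form (eq_affine_mx F uv); congr (_ * _).
by apply: eq_bigr => i _; rewrite uv.
Qed.

(* Stokes on one cell: the cofactors of a row other than the row of ones sum
   to 0. *)
Lemma cell_volE F (k0 : 'I_p.+1) x s : cell_vol F x s =
  - (-1) ^+ k0.+1 *
    \sum_(j < p.+2)
      (-1) ^+ j * facet_form F k0 (fun i => vertex x s (lift j i)).
Proof.
set A := affine_mx F (vertex x s); set r := lift ord0 k0.
have A0 j : A ord0 j = 1 by rewrite mxE unlift_none.
have Ar j : A r j = F k0 (vertex x s j) by rewrite mxE liftK.
have cof0 : \sum_j cofactor A r j = 0.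
  have /matrixP/(_ ord0 r) := mul_mx_adj A; rewrite !mxE /= mulr0n => E.
  rewrite -[RHS]E.
  by apply: eq_bigr => j _; rewrite A0 mul1r mxE.
(* The new factor is minus the sum over the vertices other than [j], so it depends only on the facet
   opposite [j]. *)
have -> : cell_vol F x s = \sum_j (A r j - \sum_i A r i) * cofactor A r j.
  under [RHS]eq_bigr do rewrite mulrBl.
  by rewrite sumrB -big_distrr /= cof0 mulr0 subr0 -(expand_det_row _ r).
rewrite mulNr big_distrr -[RHS]sumrN; apply: eq_bigr => j _ /=.
rewrite (bigD1_ord j) //= opprD addrA subrr sub0r mulNr; congr (- _).
rewrite /cofactor /facet_form exprD; set d := \det _; set d' := \det _.
have -> : d = d' by congr (\det _); apply/matrixP => a b; rewrite !mxE.
under eq_bigr do rewrite Ar.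
rewrite [X in (-1) ^+ X * _]/= /bump leq0n add1n. ring.
Qed.

Lemma row_const_det0 n (A : 'M[int]_n) (i1 i2 : 'I_n) (a : int) : i1 != i2 ->
  (forall j, A i1 j = 1) -> (forall j, A i2 j = a) -> \det A = 0.
Proof.
move=> i12 A1 A2; have -> : \det A = \sum_j A i2 j * cofactor A i2 j.
  exact: expand_det_row.
have /matrixP/(_ i1 i2) := mul_mx_adj A; rewrite !mxE (negPf i12) mulr0n => E.
under eq_bigr do rewrite A2.
rewrite -big_distrr /= -[X in _ * X]/(\sum_j cofactor A i2 j).
rewrite (_ : \sum_j cofactor A i2 j = 0) ?mulr0 // -[RHS]E.
by apply: eq_bigr => j _; rewrite A1 mul1r mxE.
Qed.

(** Each end takes in all vertices of the outermost cells; the cyclic shift in [facet_sum_ends]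
    wraps one end onto the other. *)
Definition near_ends (m : nat) (k : 'I_p.+1) (f : pt -> int) (a b : int) :=
  (forall x, (x k <= 1)%N -> f x = a) /\ (forall x, (m <= x k)%N -> f x = b).

Section Stokes.
Variables (m : nat) (F : 'I_p.+1 -> pt -> int) (k0 : 'I_p.+1).
Hypothesis F0 : near_ends m k0 (F k0) 0 0.
Hypothesis Fk : forall k, k != k0 -> exists a b, near_ends m k (F k) a b.

(** For [c = k0] the sum in front vanishes; otherwise row [c] is constant, hence proportional to the
    row of ones. *)
Lemma facet_form_end (c : 'I_p.+1) (u : 'I_p.+1 -> pt) :
  (forall i, (u i c <= 1)%N) \/ (forall i, (m <= u i c)%N) ->
  facet_form F k0 u = 0.
Proof.
move=> uc; rewrite /facet_form; have [ck|ck] := eqVneq c k0.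
  rewrite big1 ?mul0r // => i _; case: F0 => F01 F02.
  by rewrite -ck in F01 F02 *; case: uc => /(_ i); [exact: F01|exact: F02].
have [a [b [Fa Fb]]] := Fk ck.
have [d Fd] : exists d, forall i, F c (u i) = d.
  by case: uc => uc; [exists a|exists b] => i; [exact: Fa|exact: Fb].
have rc : lift ord0 k0 != lift ord0 c by rewrite (inj_eq lift_inj) eq_sym.
have r0 : lift ord0 k0 != ord0 by rewrite eq_sym neq_lift.
have [i1 i1E _] := unlift_some r0; have [i2 i2E _] := unlift_some rc.
rewrite (@row_const_det0 _ _ i1 i2 d) ?mulr0 //.
- apply/eqP => e; have := neq_lift ord0 c.
  by rewrite [X in X != _]i1E [X in _ != X]i2E e eqxx.
- by move=> j; rewrite !mxE -i1E unlift_none.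
- by move=> j; rewrite !mxE -i2E liftK /= Fd.
Qed.

Let facet_sum (j : 'I_p.+2) : int :=
  \sum_(y : {ffun 'I_p.+1 -> 'I_m.+1}) \sum_(s : 'S_p.+1)
    (-1) ^+ s * facet_form F k0 (fun i => vertex (boxpt y) s (lift j i)).

(** Exchanging the steps [a] and [a + 1] moves only the vertex left out, so two cells of opposite
    sign share this facet. *)
Lemma facet_sum_inner (a : 'I_p) : facet_sum (lift ord0 (lift ord_max a)) = 0.
Proof.
rewrite /facet_sum big1 // => y _; set j := lift _ _.
pose i0 : 'I_p.+1 := lift ord_max a; pose i1 : 'I_p.+1 := lift ord0 a.
have n01 : i0 != i1 by rewrite -val_eqE /= /bump leq0n leqNgt ltn_ord /=; lia.
set S := \sum_s _; suff SS : S = - S.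
  by have : S + S = 0; [rewrite {1}SS addNr|lia].
rewrite {1}/S (reindex_inj (mulIg (tperm i0 i1))) -sumrN.
apply: eq_bigr => s _ /=; rewrite odd_permM odd_tperm n01 addbT.
rewrite signrN mulNr; congr (- (_ * _)).
apply: eq_facet_form => i; apply/ffunP => c; rewrite !ffunE permM.
congr (_ + nat_of_bool _)%N.
have ji : (lift j i : nat) != j by rewrite eq_sym (inj_eq val_inj) neq_lift.
move: ji; rewrite /j /=; set t := bump _ i.
rewrite /bump leq0n leqNgt ltn_ord /= => ta.
case: tpermP => [->|->|];
  by rewrite /= /bump ?leq0n ?[(p <= a)%N]leqNgt ?ltn_ord /=; lia.
Qed.

(** Leaving out the first vertex gives the same facet as leaving out the last one in the cell that
    starts at the second vertex and takes the first step last. This rotation of the steps has sign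
    [(-1) ^+ p]. *)
Lemma facet_sum_ends : facet_sum ord0 = (-1) ^+ p * facet_sum ord_max.
Proof.
pose rot : 'S_p.+1 := lift_perm ord0 ord_max 1.
pose sh s (y : {ffun 'I_p.+1 -> 'I_m.+1}) : {ffun 'I_p.+1 -> 'I_m.+1} :=
  [ffun c => if s c == ord0 then ordS (y c) else y c].
pose shV s (y : {ffun 'I_p.+1 -> 'I_m.+1}) : {ffun 'I_p.+1 -> 'I_m.+1} :=
  [ffun c => if s c == ord0 then ord_pred (y c) else y c].
have sh_bij s : bijective (sh s).
  exists (shV s) => y; apply/ffunP => c; rewrite !ffunE; case: eqP => //.
    by rewrite ordSK.
  by rewrite ord_predK.
rewrite /facet_sum exchange_big [in RHS]exchange_big /= big_distrr /=.
rewrite [RHS](reindex_inj (mulIg rot)) /=; apply: eq_bigr => s _.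
rewrite [X in _ * X](reindex (sh s)) /=; last exact/onW_bij/sh_bij.
rewrite big_distrr /=; apply: eq_bigr => y _.
rewrite odd_permM odd_lift_perm /= odd_perm1 addbF.
have sgn : (-1) ^+ p * (-1) ^+ (s (+) odd p) = (-1) ^+ s :> int.
  by rewrite -signr_odd; case: (odd p); case: (odd_perm s).
rewrite mulrA sgn; congr (_ * _).
pose c0 := (s^-1)%g ord0.
have sc c : (s c == ord0) = (c == c0).
  by rewrite /c0 -[RHS](inj_eq (@perm_inj _ s)) permKV.
have rotE c (i : 'I_p.+1) :
    (rot (s c) < (lift ord_max i : 'I_p.+2))%N = (c != c0) && (s c < i.+1)%N.
  rewrite -sc /rot; case: (unliftP ord0 (s c)) => [j ->|->].
    by rewrite lift_perm_lift perm1 eq_sym neq_lift !lift_max.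
  by rewrite lift_perm_id eqxx lift_max ltnNge leq_ord.
have [ym|ym] := ltnP (y c0) m.
  apply: eq_facet_form => i; apply/ffunP => c; rewrite !ffunE permM rotE sc.
  have [->|cc] := eqVneq c c0; last by rewrite /= /bump.
  have -> : s c0 = ord0 by apply/eqP; rewrite sc.
  by rewrite /= modn_small ?ltnS //; lia.
(* When the shift wraps around, the two facets lie at opposite ends, and both forms are 0. *)
rewrite (@facet_form_end c0) ?(@facet_form_end c0) //.
  left=> i; rewrite !ffunE permM rotE sc eqxx /=.
  have -> : (y c0 : nat) = m by have := ltn_ord (y c0); lia.
  by rewrite modnn.
by right=> i; rewrite !ffunE /= (leq_trans ym) ?leq_addr.
Qed.

Lemma Stokes_total_vol : total_vol m F = 0.
Proof.
have -> : total_vol m F =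
    - (-1) ^+ k0.+1 * \sum_(j < p.+2) (-1) ^+ j * facet_sum j.
  rewrite /total_vol.
  under eq_bigr do under eq_bigr do rewrite (cell_volE F k0) mulrCA big_distrr.
  rewrite /= big_distrr /=.
  under [RHS]eq_bigr do rewrite /facet_sum !big_distrr /=.
  rewrite [RHS]exchange_big /=; apply: eq_bigr => y _.
  under [RHS]eq_bigr do rewrite !big_distrr /=.
  rewrite [RHS]exchange_big /=; apply: eq_bigr => s _.
  by rewrite big_distrr; apply: eq_bigr => j _ /=; rewrite [X in _ * X]mulrCA.
rewrite big_ord_recl [X in _ + X]big_ord_recr /= big1 => [|a _]; last first.
  have -> : lift ord0 (widen_ord (leqnSn p) a) = lift ord0 (lift ord_max a).
    by apply: val_inj; rewrite /= /bump [(p <= a)%N]leqNgt ltn_ord.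
  by rewrite facet_sum_inner mulr0.
have -> : lift ord0 ord_max = ord_max :> 'I_p.+2 by exact: val_inj.
rewrite [X in _ * X](_ : _ = 0) ?mulr0 // facet_sum_ends /bump add1n.
by rewrite exprS expr0 mul1r add0r mulN1r mulNr addrN.
Qed.

End Stokes.

(** The determinant is linear in row [k0], and [F k0 - F' k0] vanishes at both ends, so Stokes
    applies to the difference. *)
Lemma total_vol_replace m F F' (k0 : 'I_p.+1) a b :
  near_ends m k0 (F k0) a b -> near_ends m k0 (F' k0) a b ->
  (forall k, k != k0 -> F' k = F k) ->
  (forall k, k != k0 -> exists a b, near_ends m k (F k) a b) ->
  total_vol m F = total_vol m F'.
Proof.
move=> [Fa Fb] [Fa' Fb'] FF' Fk; apply/eqP; rewrite -subr_eq0; apply/eqP.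
pose H k x : int := if k == k0 then F k x - F' k x else F k x.
have H0 : near_ends m k0 (H k0) 0 0.
  split=> x xk; rewrite /H eqxx; first by rewrite Fa ?Fa' ?subrr.
  by rewrite Fb ?Fb' ?subrr.
rewrite -[RHS](Stokes_total_vol H0) => [|k kk0]; last first.
  have [c [d [Fc Fd]]] := Fk k kk0; exists c, d.
  by split=> x xk; rewrite /H (negPf kk0); [exact: Fc|exact: Fd].
rewrite /total_vol -sumrB; apply: eq_bigr => y _; rewrite -sumrB.
apply: eq_bigr => s _; rewrite -mulrBr; congr (_ * _).
rewrite /cell_vol; set u := vertex _ _; apply/eqP; rewrite subr_eq addrC.
apply/eqP; rewrite -[\det (affine_mx F' u)]mul1r -[\det (affine_mx H u)]mul1r.
apply: (determinant_multilinear (i0 := lift ord0 k0)).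
- by apply/rowP => j; rewrite !mxE liftK /= /H eqxx !mul1r addrC subrK.
- apply/matrixP => i j; rewrite !mxE; case: unliftP => [k Ek|//] /=.
  by rewrite FF' // -(inj_eq (@lift_inj _ ord0)) -Ek eq_sym neq_lift.
- apply/matrixP => i j; rewrite !mxE; case: unliftP => [k Ek|//] /=.
  rewrite /H ifF //; apply/negbTE.
  by rewrite -(inj_eq (@lift_inj _ ord0)) -Ek eq_sym neq_lift.
Qed.

(** The coordinates are replaced one at a time: [H i] has those below [i] from [G]. *)
Lemma total_vol_ends m F G (a b : 'I_p.+1 -> int) :
  (forall k, near_ends m k (F k) (a k) (b k)) ->
  (forall k, near_ends m k (G k) (a k) (b k)) -> total_vol m F = total_vol m G.
Proof.
move=> Fab Gab; pose H i (k : 'I_p.+1) := if (k < i)%N then G k else F k.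
have Hab i k : near_ends m k (H i k) (a k) (b k) by rewrite /H; case: ifP.
have step i : (i <= p.+1)%N -> total_vol m F = total_vol m (H i).
  elim: i => [|i IH] ip; first by [].
  rewrite IH 1?ltnW //; pose k0 := Ordinal ip.
  apply: (@total_vol_replace _ _ _ k0 (a k0) (b k0)) => // k kk0; last first.
    by exists (a k), (b k).
  rewrite /H ltnS leq_eqVlt; case: eqP => // ki.
  by case/eqP: kk0; exact: val_inj.
rewrite (step p.+1) // /total_vol; apply: eq_bigr => y _; apply: eq_bigr => s _.
rewrite /cell_vol; congr (_ * \det _); apply/matrixP => k j; rewrite !mxE.
by case: unliftP => //= k' _; rewrite /H ltn_ord.
Qed.

Definition threshold (t : nat) (k : 'I_p.+1) (x : pt) : int := (t <= x k)%N.

(** At the constant point [t] the matrix is a row permutation of a unitriangular one; elsewhere a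
    coordinate [x k != t] stays on one side of the threshold, so its row is constant. *)
Lemma cell_vol_threshold t x s : cell_vol (threshold t.+1) x s =
  if x == [ffun=> t] then (-1) ^+ s else 0.
Proof.
rewrite /cell_vol; have [->|/eqP xt] := eqVneq.
  pose T : 'M[int]_p.+2 := \matrix_(i, j) ((i <= j)%N : int).
  have -> : affine_mx (threshold t.+1) (vertex [ffun=> t] s) =
      row_perm (lift_perm ord0 ord0 s) T.
    apply/matrixP => i j; rewrite !mxE; case: unliftP => [k ->|->] /=.
      by rewrite lift_perm_lift /threshold !ffunE -[t.+1]addn1 leq_add2l lt0b.
    by rewrite lift_perm_id.
  rewrite row_permE det_mulmx det_perm odd_lift_perm /=.
  rewrite -[\det T]det_tr det_trig; last first.
    by apply/is_trig_mxP => i j ij; rewrite !mxE leqNgt ij.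
  by rewrite big1 ?mulr1 // => i _; rewrite !mxE leqnn.
have [k xk|xt'] := pickP (fun k => x k != t); last first.
  by case: xt; apply/ffunP => k; rewrite ffunE; apply/eqP/negbFE/xt'.
apply: (@row_const_det0 _ _ ord0 (lift ord0 k) (t < x k)%N) => // j.
  by rewrite mxE unlift_none.
by rewrite mxE liftK /= /threshold ffunE; case: leqP; case: leqP => //; lia.
Qed.

Lemma total_vol_threshold m t : (t <= m)%N ->
  total_vol m (threshold t.+1) = (p.+1)`!%:R.
Proof.
move=> tm; rewrite /total_vol (bigD1 [ffun=> inord t]) //= [X in _ + X]big1.
  have -> : boxpt [ffun=> inord t : 'I_m.+1] = [ffun=> t].
    by apply/ffunP => c; rewrite !ffunE /= inordK.
  rewrite addr0 -card_Sn -sumr_const; apply: eq_bigr => s _.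
  by rewrite cell_vol_threshold eqxx -expr2 sqrr_sign.
move=> y yt; apply: big1 => s _; rewrite cell_vol_threshold ifF ?mulr0 //.
apply: contraNF yt => /eqP/ffunP yt; apply/eqP/ffunP => c.
by apply: val_inj; have := yt c; rewrite !ffunE /= inordK.
Qed.

(* The coordinate thresholds of [q] have the same total volume as those of the
   identity, although every cell has two vertices of the same colour. *)
Lemma no_bounded_colouring (B : nat) (col : pt -> 'I_p.+1)
    (q : pt -> 'I_p.+1 -> nat) :
  (forall (v : pt) k, (q v k <= v k + B)%N /\ (v k <= q v k + B)%N) ->
  (forall v w : pt, (forall k, (v k <= (w k).+1)%N /\ (w k <= (v k).+1)%N) ->
     col v = col w -> q v =1 q w) -> False.
Proof.
(* With an error of at most [B], [v k <= 1] forces [q v k <= t], and [v k >= m] forces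
   [q v k > t]. *)
move=> qB colq; pose t := B.+1; pose m := (B.+1).*2.
pose f (k : 'I_p.+1) (v : pt) : int := (t < q v k)%N.
have fE : total_vol m f = total_vol m (threshold t.+1).
  apply: (@total_vol_ends _ _ _ (fun=> 0) (fun=> 1)) => k; split=> v vk.
  - by rewrite /f; have [] := qB v k; case: ltnP => //; lia.
  - by rewrite /f; have [] := qB v k; case: ltnP => //; lia.
  - by rewrite /threshold; case: ltnP => //; lia.
  - by rewrite /threshold; case: ltnP => //; lia.
have f0 : total_vol m f = 0.
  apply: big1 => y _; apply: big1 => s _; set x := boxpt y.
  have [|ninj] := boolP (injectiveb (fun j => col (vertex x s j))).
    by move/injectiveP/leq_card; rewrite !card_ord ltnn.
  have [j1 [j2 j12 e]] := injectivePn _ ninj.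
  rewrite /cell_vol -det_tr (determinant_alternate j12) ?mulr0 // => k.
  rewrite !mxE; case: unliftP => [k' _|//] /=.
  rewrite /f (colq (vertex x s j1) (vertex x s j2)) // => c.
  by rewrite !ffunE; lia.
move/eqP: fE; rewrite f0 total_vol_threshold; last by rewrite /t /m; lia.
by rewrite eq_sym pnatr_eq0 -leqn0 leqNgt fact_gt0.
Qed.

End KuhnCells.

(** * The lower bound *)

Lemma Ord_le_onat (M : set {fset nat}) n :
  (forall s, M s -> s != fset0 /\ (#|` s| <= n)%N) -> Ord_le M (onat n).
Proof.
elim: n M => [|n IH] M Mn.
  left; split; first by case=> -[].
  apply/seteqP; split=> // s /Mn[+ ].
  by rewrite leqn0 cardfs_eq0 => /negPf ->.
right; split; first exact: inhabits tt.
move=> a; exists tt; apply: IH => t [tN [Mat at_]]; split=> //.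
by have [_] := Mn _ Mat; rewrite cardfsU1 at_.
Qed.

(** Moving an element [a] of [s] into the derivation lowers both the cardinality and the ordinal by
    1. *)
Lemma card_le_of_Ord_le (M : set {fset nat}) n s :
  Ord_le M (onat n) -> M s -> (#|` s| <= n)%N.
Proof.
elim: n M s => [|n IH] M s /=.
  by case=> [[_ ->]//|[[[]]]].
case=> [[ni]|[_ Mn] Ms]; first by case: ni; exact: inhabits tt.
have [->|/fset0Pn[a sa]] := eqVneq s fset0; first by rewrite cardfs0.
rewrite (cardfsD1 a) sa add1n ltnS.
have [->|sa0] := eqVneq (s `\ a)%fset fset0; first by rewrite cardfs0.
have [[]] := Mn a; move/IH; apply.
by split=> //; split; [rewrite fsetD1K|rewrite !inE eqxx].
Qed.

(** An ordinal below [omega] is at most some [onat n], which would bound the cardinality of all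
    members of [M]. *)
Lemma Ord_eq_omega (M : set {fset nat}) :
  (forall a, exists n, forall t, derived M a t -> (#|` t| <= n)%N) ->
  (forall n, exists2 s, M s & (n < #|` s|)%N) -> Ord_eq M omega.
Proof.
move=> upper lower; split.
  right; split=> [|a]; first exact: inhabits 0%N.
  have [n an] := upper a; exists n; apply: Ord_le_onat => t tM.
  by split; [case: tM|exact: an].
move=> [y [[n yn] /(Ord_le_mono yn) Mn]].
have [s Ms] := lower n; rewrite ltnNge.
by rewrite (card_le_of_Ord_le Mn Ms).
Qed.

Section families.
Context {R : realType} {T : metricType R}.

Lemma mdist_le_diam (A : set T) (x y : T) (r : R) :
  (diam A <= r%:E)%E -> A x -> A y -> mdist x y <= r.
Proof.
move=> Ar Ax Ay; rewrite -lee_fin; apply: le_trans Ar.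
by apply: ereal_sup_ubound; exists (x, y).
Qed.

Lemma disjoint_at_eq (r : R) (U : set (set T)) (A B : set T) (x y : T) :
  disjoint_at r U -> U A -> U B -> A x -> B y -> mdist x y < r -> A = B.
Proof.
move=> rU UA UB Ax By xyr; apply: contrapT => AB.
have := rU _ _ UA UB AB; apply/negP; rewrite -ltNge.
apply: le_lt_trans (_ : (mdist x y)%:E < _)%E; last by rewrite lte_fin.
by apply: ereal_inf_lbound; exists (x, y).
Qed.

End families.

Lemma mdist_XX (R : realType) (z z' : (Xspace R * Xspace R)%type) :
  mdist z z' = (maxn (Xdist z.1 z'.1) (Xdist z.2 z'.2))%:R :> R.
Proof. by rewrite natr_max. Qed.

(** * Scaled copies of the lattice points in the layers *)

Section lattice_points.
Context {R : realType}.
Variable n : nat.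
Local Notation pt := {ffun 'I_n.+1 -> nat}.

Lemma lattice_dvd (v : pt) :
  all (fun z => ((2 ^ n.+1)%N %| z)%Z) [tuple (2 ^ n.+1 * v i)%N%:Z | i < n.+1].
Proof. by apply/allP => _ /mapP[i _ ->]; rewrite PoszM dvdz_mulr. Qed.

Definition lattice_pt (v : pt) : Xspace R :=
  existT (fun i => layer i.+1) n
    (exist (fun t : n.+1.-tuple int => is_true (all _ t)) _ (lattice_dvd v)).

Lemma Xcoord_lattice_pt v (k : 'I_n.+1) :
  (Xcoord (lattice_pt v))`_k = (2 ^ n.+1 * v k)%N%:Z.
Proof.
rewrite -(tnth_mktuple (fun i : 'I_n.+1 => (2 ^ n.+1 * v i)%N%:Z)).
by rewrite (tnth_nth 0).
Qed.

Lemma Xdist_lattice_pt (v w : pt) d : reflect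
  (forall k, (2 ^ n.+1 * v k <= 2 ^ n.+1 * w k + d)%N /\
     (2 ^ n.+1 * w k <= 2 ^ n.+1 * v k + d)%N)
  (Xdist (lattice_pt v) (lattice_pt w) <= d)%N.
Proof.
apply: (iffP (XdistP _ _ _)) => [[vw _ _] k|vw].
  by have := vw k; rewrite !Xcoord_lattice_pt; lia.
split=> [m||]; rewrite ?leq_addl //.
have [mn|nm] := ltnP m n.+1; last by rewrite !nth_default ?size_Xcoord.
have /= vwk := vw (Ordinal mn).
by rewrite !(Xcoord_lattice_pt _ (Ordinal mn)); lia.
Qed.

End lattice_points.

Lemma asdim_obstr_XX (R : realType) (n : nat) :
  exists2 s : {fset nat}, asdim_obstr (Xspace R * Xspace R)%type s &
    (n < #|` s|)%N.
Proof.
(* All [n + 1] indices exceed [N], the distance of neighbours in the lattice. *)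
pose N := (2 ^ n.+1)%N; pose s : {fset nat} := [fset i in iota N.+1 n.+1]%fset.
have mem_s i : (i \in s) = (N < i <= N + n.+1)%N.
  by rewrite in_fset mem_iota addSn ltnS.
have card_s : #|` s| = n.+1.
  by rewrite /s card_fseq undup_id ?iota_uniq // size_iota.
exists s; last by rewrite card_s.
split; first by rewrite /FinN /= -cardfs_gt0 card_s.
move=> [U [Us Ucov]].
pose e (v : {ffun 'I_n.+1 -> nat}) : (Xspace R * Xspace R)%type :=
  (lattice_pt v, lattice_pt v).
have edist v w : mdist (e v) (e w) = (Xdist (e v).1 (e w).1)%:R :> R.
  by rewrite mdist_XX maxnn.
have [r rs] : {r : nat -> R & forall i, i \in s ->
    0 < r i /\ forall A, U i A -> (diam A <= (r i)%:E)%E}.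
  apply: (@boolp.choice nat R (fun i r => i \in s ->
    0 < r /\ forall A, U i A -> (diam A <= r%:E)%E)) => i.
  have [is_|nis] := boolP (i \in s); last by exists 0.
  by have [[r r0 rU] _] := Us i is_; exists r.
pose B := \max_(i <- s) Num.bound (r i).
have rB i : i \in s -> r i <= B%:R.
  move=> is_; have [r0 _] := rs i is_.
  apply: le_trans (ltW (archi_boundP (ltW r0))) _.
  rewrite ler_nat.
  exact: (leq_bigmax_seq (F := fun i => Num.bound (r i))) is_ _.
have [ci ciP] : {c : {ffun 'I_n.+1 -> nat} ->
      nat * set (Xspace R * Xspace R)%type &
    forall v, [/\ (c v).1 \in s, U (c v).1 (c v).2 & (c v).2 (e v)]}.
  apply: (@boolp.choice _ _ (fun v c =>
    [/\ c.1 \in s, U c.1 c.2 & c.2 (e v)])) => v.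
  have : setT (e v) by [].
  by rewrite -Ucov => -[A [i is_ UA] Av]; exists (i, A).
(* The point is chosen from the set [(ci v).2] alone, so equal sets give equal values of [q]. *)
pose q v := xget [ffun=> 0%N] [set w | (ci v).2 (e w)].
have qP v : (ci v).2 (e (q v)).
  have [_ _ Av] := ciP v.
  by apply: (@xgetPex _ [ffun=> 0%N] [set w | (ci v).2 (e w)]); exists v.
pose col v : 'I_n.+1 := inord ((ci v).1 - N.+1).
apply: (@no_bounded_colouring n B col q) => [v k|v w vw cvw k].
  have [is_ UA Av] := ciP v; have [_ rU] := rs _ is_.
  have := le_trans (mdist_le_diam (rU _ UA) Av (qP v)) (rB _ is_).
  rewrite edist ler_nat => /Xdist_lattice_pt /(_ k).
  have : (0 < 2 ^ n.+1)%N by rewrite expn_gt0.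
  move: (2 ^ n.+1)%N => M M0 [vq qv]; split.
    by rewrite -(leq_pmul2l M0) mulnDr (leq_trans qv) // leq_add2l leq_pmull.
  by rewrite -(leq_pmul2l M0) mulnDr (leq_trans vq) // leq_add2l leq_pmull.
have [is_ UA Av] := ciP v; have [is' UA' Aw] := ciP w.
have cE : (ci w).1 = (ci v).1.
  move/(congr1 val): cvw; move: is_ is'; rewrite !mem_s => i1 i2.
  by rewrite /= !inordK; lia.
rewrite /q (_ : (ci v).2 = (ci w).2) //.
rewrite cE in UA'; have [_ disj] := Us _ is_.
apply: (disjoint_at_eq disj UA UA' Av Aw); rewrite edist ltr_nat.
apply: leq_ltn_trans (_ : N < _)%N; last by move: is_; rewrite mem_s => /andP[].
apply/Xdist_lattice_pt => c; have [] := vw c.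
by rewrite -/N; nia.
Qed.

(** * The upper bound *)

Lemma eq_of_absz_modz (n : nat) (a b : int) : (0 < n)%N ->
  absz (a %% n)%Z = absz (b %% n)%Z -> (absz (a - b)%R < n)%N -> a = b.
Proof.
move=> n0 ab abn; have abE : (a %% n)%Z = (b %% n)%Z by lia.
rewrite (divz_eq a n) (divz_eq b n) abE in abn *.
suff -> : (a %/ n)%Z = (b %/ n)%Z by [].
move: abn; rewrite opprD addrACA subrr addr0 -mulrBl abszM /=.
rewrite -[X in (_ < X)%N]mul1n ltn_pmul2r //; lia.
Qed.

(** * Distances and colourings in X *)

Section Xspace_geometry.
Context {R : realType}.
Implicit Types x y : Xspace R.

Lemma le_Xdist_coord x y m :
  (absz ((Xcoord x)`_m - (Xcoord y)`_m)%R <= Xdist x y)%N.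
Proof. by have /XdistP[] := leqnn (Xdist x y). Qed.

Lemma Xcoord_dvd x m : ((2 ^ Xlen x)%N %| (Xcoord x)`_m)%Z.
Proof.
have [mx|xm] := ltnP m (size (Xcoord x)); last by rewrite nth_default ?dvdz0.
by have /allP := valP (tagged x); apply; exact: mem_nth.
Qed.

Lemma eq_of_Xcoord x y : Xlen x = Xlen y ->
  (forall m, (Xcoord x)`_m = (Xcoord y)`_m) -> x = y.
Proof.
move=> lxy cxy; apply/Xdist_eq0/eqP; rewrite -leqn0; apply/XdistP.
by split=> [m||]; rewrite ?cxy ?subrr // lxy.
Qed.

Lemma triS n : tri n.+1 = (tri n + n)%N.
Proof. by rewrite /tri big_nat_recr. Qed.

(** The last summand of the term [c] is [Xlen y - 1], already at least [L]. *)
Lemma Xdist_ltn_len x y L :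
  (Xlen x < Xlen y)%N -> (L < Xlen y)%N -> (L <= Xdist x y)%N.
Proof.
have /XdistP[_ _] := leqnn (Xdist x y).
case: (Xlen y) => // l; rewrite triS => + xl Ll.
have := @tri_homo (Xlen x) l xl; lia.
Qed.

(** Within one layer, some coordinates differ by a nonzero multiple of [2 ^ Xlen x]; between layers
    the term [c] suffices. *)
Lemma Xdist_far x y L : x <> y -> (L < Xlen x)%N -> (L <= Xdist x y)%N.
Proof.
move=> xy Lx; have [lxy|lyx|lxy] := ltngtP (Xlen x) (Xlen y).
- by apply: Xdist_ltn_len => //; exact: ltn_trans lxy.
- by rewrite Xdist_sym; exact: Xdist_ltn_len.
have [m /eqP cxy] : exists m, (Xcoord x)`_m <> (Xcoord y)`_m.
  by apply/existsNP => cxy; apply: xy; exact: eq_of_Xcoord.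
apply: leq_trans (le_Xdist_coord x y m).
apply: leq_trans (_ : 2 ^ Xlen x <= _)%N; last first.
  rewrite dvdn_leq ?absz_gt0 ?subr_eq0 //.
  have := Xcoord_dvd y m; rewrite -lxy => dy.
  by have := rpredB (Xcoord_dvd x m) dy; rewrite dvdzE.
by rewrite (leq_trans (ltnW Lx)) // ltnW // ltn_expl.
Qed.

Lemma Xdist_short x y L b : (Xlen x <= L)%N -> (Xlen y <= L)%N ->
  (forall m, (m < L)%N -> absz ((Xcoord x)`_m - (Xcoord y)`_m)%R <= b)%N ->
  (Xdist x y <= b + tri L)%N.
Proof.
move=> xL yL cxy; apply/XdistP; split=> [m||].
- have [mL|Lm] := ltnP m L; first by rewrite (leq_trans (cxy m mL)) ?leq_addr.
  by rewrite !nth_default ?size_Xcoord ?(leq_trans _ Lm).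
- by have := tri_homo xL; lia.
- by have := tri_homo yL; lia.
Qed.

(* Points of layers of index > r are at distance >= r from all others; the
   remaining ones are coloured by their layer and coordinates modulo r + 1. *)
Lemma separating_colouring r : exists K (kappa : Xspace R -> 'I_K),
  forall y y', kappa y = kappa y' -> y <> y' -> (r <= Xdist y y')%N.
Proof.
pose T := option ('I_r.+1 * {ffun 'I_r.+1 -> 'I_r.+1})%type.
pose k y : T := if (Xlen y <= r)%N then Some (inord (Xlen y),
  [ffun c : 'I_r.+1 => inord (absz ((Xcoord y)`_c %% r.+1)%Z)]) else None.
exists #|{: T}|, (enum_rank \o k) => y y' /enum_rank_inj.
rewrite /k; case: (leqP (Xlen y) r) => yr; case: (leqP (Xlen y') r) => y'r //
  kk yy'; last exact: Xdist_far.
case: kk => /(congr1 val); rewrite /= !inordK ?ltnS // => lyy' /ffunP cyy'.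
rewrite leqNgt; apply/negP => dr; apply: yy'; apply: eq_of_Xcoord => // m.
have [mr|rm] := ltnP m r.+1; last first.
  by rewrite !nth_default // size_Xcoord; lia.
have := cyy' (Ordinal mr); rewrite !ffunE => /(congr1 val) /=.
have := le_Xdist_coord y y' m.
have mod_lt z : (absz (z %% r.+1)%Z < r.+1)%N.
  by rewrite -ltz_nat gez0_abs ?modz_ge0 ?ltz_pmod.
rewrite !inordK // => d_ ee; apply: (eq_of_absz_modz _ ee) => //.
by rewrite (leq_ltn_trans d_) // ltnS ltnW.
Qed.

End Xspace_geometry.

Lemma absz_divz_le (D e : nat) (a b : int) : (0 < D)%N ->
  (absz ((a %/ D)%Z - (b %/ D)%Z)%R <= e)%N -> (absz (a - b)%R <= e.+1 * D)%N.
Proof. by move=> D0; nia. Qed.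

Lemma absz_divz_ge (D : nat) (a b : int) : (0 < D)%N ->
  (2 <= absz ((a %/ D)%Z - (b %/ D)%Z)%R)%N -> (D <= absz (a - b)%R)%N.
Proof. by move=> D0; nia. Qed.

Lemma eq_of_residue (K k k' : nat) (b : int) : (k < K)%N -> (k' < K)%N ->
  ((b - (2 * k)%N%:Z) %% (2 * K)%N)%Z = 0 ->
  ((b - (2 * k')%N%:Z) %% (2 * K)%N)%Z = 0 -> k = k'.
Proof.
move=> kK k'K e e'.
suff : b - (2 * k)%N%:Z = b - (2 * k')%N%:Z by lia.
by apply: (@eq_of_absz_modz (2 * K)); rewrite ?e ?e'; lia.
Qed.

(** A multiple of [M] lies strictly between [a] and [b]. *)
Lemma divz_neq_gap (M : nat) (a b : int) : (0 < M)%N ->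
  (a %/ M)%Z <> (b %/ M)%Z -> (a %% M)%Z <> 0 -> (b %% M)%Z <> 0 ->
  (2 <= absz (a - b)%R)%N.
Proof.
move=> M0; rewrite [in X in _ -> _ -> _ -> X](divz_eq a M).
rewrite [in X in _ -> _ -> _ -> X](divz_eq b M).
have Mz : M%:Z != 0 by rewrite eqz_nat -lt0n.
have := ltz_pmod a (M0 : 0 < M%:Z); have := ltz_pmod b (M0 : 0 < M%:Z).
have := modz_ge0 a Mz; have := modz_ge0 b Mz.
move: (a %/ M)%Z (a %% M)%Z (b %/ M)%Z (b %% M)%Z => q s q' s'.
move=> s'0 s0 s'M sM /eqP; rewrite neq_lt => /orP[] qq sn s'n.
  have : (q + 1) * M <= q' * M by rewrite ler_wpM2r // lezD1.
  by rewrite mulrDl mul1r; lia.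
have : (q' + 1) * M <= q * M by rewrite ler_wpM2r // lezD1.
by rewrite mulrDl mul1r; lia.
Qed.

(** * Covers of X * X by bounded pieces *)

Section coverings.
Context {R : realType}.
Local Notation X := (Xspace R).
Local Notation XX := (Xspace R * Xspace R)%type.

Definition XXdist (z z' : XX) : nat := maxn (Xdist z.1 z'.1) (Xdist z.2 z'.2).

(* [P] is covered by bounded pieces, the fibres of [(col, id)]: the pieces of
   colour [None] are [a]-disjoint, and those of each colour in [J] are
   [r]-disjoint for a prescribed [r]. *)
Definition coverable (P : set XX) (a : nat) (J : finType) : Prop :=
  forall r : nat,
  exists (T : Type) (col : XX -> option J) (id : XX -> T) (b : nat),
  forall z z', P z -> P z' -> col z = col z' ->
    (id z = id z' -> (XXdist z z' <= b)%N) /\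
    (id z <> id z' -> ((if col z is Some _ then r else a) <= XXdist z z')%N).

Lemma XXdistC z z' : XXdist z z' = XXdist z' z.
Proof. by rewrite /XXdist Xdist_sym [Xdist z.2 _]Xdist_sym. Qed.

Lemma coverable_swap (P Q : set XX) a J :
  (forall z, Q z -> P (z.2, z.1)) -> coverable P a J -> coverable Q a J.
Proof.
move=> QP cP r; have [T [col [id [b H]]]] := cP r.
exists T, (fun z => col (z.2, z.1)), (fun z => id (z.2, z.1)), b => z z' Qz Qz'.
by move/(H _ _ (QP _ Qz) (QP _ Qz')); rewrite /XXdist /= maxnC.
Qed.

Lemma coverable_sub (P Q : set XX) a J :
  Q `<=` P -> coverable P a J -> coverable Q a J.
Proof.
move=> QP cP r; have [T [col [id [b H]]]] := cP r.
by exists T, col, id, b => z z' /QP Pz /QP Pz'; exact: H.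
Qed.

(** The colours in [J] and [K] are kept apart; only the two families of colour [None] merge, and
    these are [a]-apart. *)
Lemma coverableU (P Q : set XX) a (J K : finType) :
  (forall z z', P z -> Q z' -> (a <= XXdist z z')%N) ->
  coverable P a J -> coverable Q a K -> coverable (P `|` Q) a (J + K)%type.
Proof.
move=> PQ cP cQ r; have [T [col [id [b H]]]] := cP r.
have [T' [col' [id' [b' H']]]] := cQ r.
exists (T + T')%type,
  (fun z => if `[< P z >] then omap inl (col z) else omap inr (col' z)),
  (fun z => if `[< P z >] then inl (id z) else inr (id' z)), (maxn b b').
move=> z z' PQz PQz'; case: asboolP => Pz; case: asboolP => Pz'.
- move=> cc; have {}cc : col z = col z'.
    by case: (col z) (col z') cc => [j|] [j'|] //= [->].
  have [Hz Hz'] := H z z' Pz Pz' cc; split=> [[/Hz h]|ne].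
    by rewrite leq_max h.
  have /Hz' : id z <> id z' by move=> e; apply: ne; rewrite e.
  by case: (col z).
- case: PQz' => // Qz'; case: (col z) (col' z') => [j|] [j'|] //= _.
  by split=> // _; exact: PQ.
- case: PQz => // Qz; case: (col' z) (col z') => [j|] [j'|] //= _.
  by split=> // _; rewrite XXdistC; exact: PQ.
- case: PQz => // Qz; case: PQz' => // Qz' cc; have {}cc : col' z = col' z'.
    by case: (col' z) (col' z') cc => [j|] [j'|] //= [->].
  have [Hz Hz'] := H' z z' Qz Qz' cc; split=> [[/Hz h]|ne].
    by rewrite leq_max h orbT.
  have /Hz' : id' z <> id' z' by move=> e; apply: ne; rewrite e.
  by case: (col' z).
Qed.

Variable L : nat.
Let short : set X := [set x | (Xlen x <= L)%N].
Let long : set X := [set x | (L < Xlen x)%N].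

Lemma coverable_long a : (a <= L)%N ->
  coverable [set z | long z.1 /\ long z.2] a void.
Proof.
move=> aL r; exists XX, (fun=> None), id, 0%N => z z' [z1 z2] [z'1 z'2] _ /=.
split=> [->|zz']; first by rewrite /XXdist !Xdistxx.
rewrite (leq_trans aL) // /XXdist leq_max.
have [e1|n1] := pselect (z.1 = z'.1); last by rewrite Xdist_far.
have [e2|n2] := pselect (z.2 = z'.2); last by rewrite (Xdist_far n2) ?orbT.
by case: zz'; case: (z) (z') e1 e2 => [? ?] [? ?] /= -> ->.
Qed.

(** The index of a cube of side [D]; the first [L] coordinates are all those of a short point. *)
Definition block (D : nat) (x : X) : {ffun 'I_L -> int} :=
  [ffun k : 'I_L => ((Xcoord x)`_k %/ D)%Z].

Definition even_coords (u : {ffun 'I_L -> int}) : {ffun 'I_L -> bool} :=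
  [ffun k => (u k %% 2)%Z == 0].

Lemma block_near D e x y : (0 < D)%N -> short x -> short y ->
  (forall k, absz (block D x k - block D y k)%R <= e)%N ->
  (Xdist x y <= e.+1 * D + tri L)%N.
Proof.
move=> D0 xL yL xy; apply: Xdist_short => // m mL.
by have := xy (Ordinal mL); rewrite !ffunE; exact: absz_divz_le.
Qed.

Lemma block_far D x y k : (0 < D)%N ->
  (2 <= absz (block D x k - block D y k)%R)%N -> (D <= Xdist x y)%N.
Proof.
move=> D0; rewrite !ffunE => /(absz_divz_ge D0) /leq_trans; apply.
exact: le_Xdist_coord.
Qed.

(** Distinct integers of equal parity differ by at least 2, which leaves a whole block in
    between. *)
Lemma block_parity_far D x y : (0 < D)%N ->
  even_coords (block D x) = even_coords (block D y) ->
  block D x <> block D y -> (D <= Xdist x y)%N.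
Proof.
move=> D0 /ffunP pxy bxy.
have [k bk] : exists k, block D x k <> block D y k.
  by apply/existsNP => e; apply: bxy; exact/ffunP.
apply: (@block_far D x y k) => //; have := pxy k.
by rewrite [in X in X -> _]ffunE [in X in _ = X -> _]ffunE; move: bk; lia.
Qed.

Lemma block_eq D x y : (0 < D)%N -> short x -> short y ->
  block D x = block D y -> (Xdist x y <= D + tri L)%N.
Proof.
move=> D0 xL yL xy; rewrite -[D in (D + _)%N]mul1n; apply: block_near => // k.
by rewrite xy subrr.
Qed.

Lemma coverable_short a : coverable [set z | short z.1 /\ short z.2] a
  ({ffun 'I_L -> bool} * {ffun 'I_L -> bool})%type.
Proof.
move=> r; pose D := r.+1.
exists ({ffun 'I_L -> int} * {ffun 'I_L -> int})%type,
  (fun z => Some (even_coords (block D z.1), even_coords (block D z.2))),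
  (fun z => (block D z.1, block D z.2)), (D + tri L)%N.
move=> z z' [z1 z2] [z'1 z'2] [p1 p2]; split=> [[b1 b2]|bb].
  by rewrite /XXdist geq_max !block_eq.
rewrite (leq_trans (leqnSn r)) // /XXdist leq_max.
have [e1|n1] := pselect (block D z.1 = block D z'.1).
  rewrite orbC block_parity_far // => e2; apply: bb.
  by rewrite e1 e2.
by rewrite block_parity_far.
Qed.

(* Each [y] owns the residue [2 * kappa y] modulo [2 * K], the factor 2 keeping
   the residues of different colours one block apart. The slabs of blocks with a
   coordinate in that residue get a colour [Some _], and what they leave of
   [short * {y}] splits into [a]-disjoint boxes. *)
Lemma coverable_mixed a : (a <= L)%N ->
  coverable [set z | short z.1 /\ long z.2] a ('I_L * {ffun 'I_L -> bool})%type.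
Proof.
move=> aL r; have [K [kappa kP]] := @separating_colouring R r.
pose D := (maxn r a).+1; have D0 : (0 < D)%N by [].
pose u (z : XX) := block D z.1.
pose sh (z : XX) (j : 'I_L) : int := u z j - (2 * kappa z.2)%N%:Z.
pose slab z j := (sh z j %% (2 * K)%N)%Z == 0.
pose w z : {ffun 'I_L -> int} := [ffun j => (sh z j %/ (2 * K)%N)%Z].
exists ({ffun 'I_L -> int} * X)%type,
  (fun z => omap (pair^~ (even_coords (u z))) [pick j | slab z j]),
  (fun z => (if [pick j | slab z j] is Some _ then u z else w z, z.2)),
  (* A box between slabs lies within [2 * K] consecutive blocks in each direction. *)
  ((2 * K).+1 * D + tri L)%N.
move=> z z' [z1 z2] [z'1 z'2]; rewrite /XXdist.
have K0 : (0 < 2 * K)%N.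
  by rewrite muln_gt0 /= (leq_trans _ (ltn_ord (kappa z.2))).
have rD : (r <= D)%N by rewrite leqW // leq_maxl.
have aD : (a <= D)%N by rewrite leqW // leq_maxr.
case: pickP => [j zj|noz]; case: pickP => [j' z'j|noz'] //=.
  move=> [jj' par]; rewrite -{}jj' in z'j; split=> [[uu' ->]|ne].
    rewrite Xdistxx maxn0 (leq_trans (block_eq D0 z1 z'1 uu')) //.
    by rewrite leq_add2r leq_pmull.
  rewrite leq_max; have [uu'|uu'] := pselect (u z = u z'); last first.
    by rewrite (leq_trans rD) // block_parity_far.
  (* One block lies in the slabs of both [z.2] and [z'.2], so these have the same colour and are
     [r]-apart. *)
  rewrite (kP z.2 z'.2) ?orbT // => [|e2]; last by apply: ne; rewrite uu' e2.
  apply: val_inj => /=; move: zj z'j; rewrite /slab /sh uu'.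
  move: (ltn_ord (kappa z.2)) (ltn_ord (kappa z'.2)).
  by move=> kK k'K /eqP e /eqP e'; exact: eq_of_residue e e'.
move=> _; split=> [[ww' e2]|ne].
  rewrite e2 Xdistxx maxn0; apply: block_near => // j.
  have wE : (sh z j %/ (2 * K)%N)%Z = (sh z' j %/ (2 * K)%N)%Z.
    by have := congr1 (fun v : {ffun 'I_L -> int} => v j) ww'; rewrite !ffunE.
  rewrite -/(u z) -/(u z') -[(2 * K)%N]mul1n.
  rewrite (_ : u z j - u z' j = sh z j - sh z' j); last by rewrite /sh e2; ring.
  by apply: absz_divz_le => //; rewrite wE subrr.
rewrite leq_max; have [e2|n2] := pselect (z.2 = z'.2); last first.
  by apply/orP; right; rewrite (leq_trans aL) // Xdist_far.
(* Over the same long point, different boxes are separated by a slab, one block of side [D >= a]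
   wide. *)
have [j wj] : exists j, w z j <> w z' j.
  by apply/existsNP => e; apply: ne; congr pair => //; exact/ffunP.
rewrite (leq_trans aD) // (@block_far D _ _ j) //.
rewrite -/(u z) -/(u z') (_ : u z j - u z' j = sh z j - sh z' j); last first.
  by rewrite /sh e2; ring.
apply: (divz_neq_gap K0); first by move: wj; rewrite !ffunE.
  by apply/eqP; rewrite [_ == _](noz j).
by apply/eqP; rewrite [_ == _](noz' j).
Qed.

(** Any two of the four products of [short] and [long] differ in some factor, where a short and a
    long point are [a]-apart; so [coverableU] merges them. *)
Lemma coverable_all a : (a <= L)%N -> exists J, coverable setT a J.
Proof.
move=> aL.
have cSG := coverable_mixed aL; have cG := coverable_long aL.
have cGS : coverable [set z | long z.1 /\ short z.2] a
    ('I_L * {ffun 'I_L -> bool})%type.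
  by apply: coverable_swap cSG => z [].
have cS := coverable_short a.
have sep x y : short x -> long y -> (a <= Xdist x y)%N.
  move=> xL Ly; rewrite (leq_trans aL) // Xdist_ltn_len //.
  exact: leq_ltn_trans xL Ly.
have sepC x y : long x -> short y -> (a <= Xdist x y)%N.
  by move=> Lx yL; rewrite Xdist_sym; exact: sep.
have dich x : short x \/ long x.
  by rewrite /short /long /=; case: leqP; [left|right].
have far (z z' : XX) : (a <= Xdist z.1 z'.1)%N \/ (a <= Xdist z.2 z'.2)%N ->
    (a <= XXdist z z')%N.
  by rewrite /XXdist leq_max => -[->//|->]; rewrite orbT.
pose P (A B : set X) : set XX := [set z | A z.1 /\ B z.2].
have sep1 z z' : P short short z -> P long long z' -> (a <= XXdist z z')%N.
  by move=> [z1 _] [z1' _]; apply: far; left; exact: sep.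
have sep2 z z' : P short long z -> P long short z' -> (a <= XXdist z z')%N.
  by move=> [z1 _] [z1' _]; apply: far; left; exact: sep.
have sep3 z z' : (P short short `|` P long long) z ->
    (P short long `|` P long short) z' -> (a <= XXdist z z')%N.
  move=> [[z1 z2]|[z1 z2]] [[z1' z2']|[z1' z2']]; apply: far.
  - by right; exact: sep.
  - by left; exact: sep.
  - by left; exact: sepC.
  - by right; exact: sepC.
have c := coverableU sep3 (coverableU sep1 cS cG) (coverableU sep2 cSG cGS).
eexists; apply: coverable_sub c => z _.
have [z1|z1] := dich z.1; have [z2|z2] := dich z.2.
- by left; left.
- by right; left.
- by right; right.
- by left; right.
Qed.

End coverings.

(** The colour [None] supplies the family of index [a], and the colours in [J] go injectively to
    indices in [t]. *)
Lemma coverable_covers (R : realType) (a : nat) (J : finType) (t : {fset nat}) :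
  coverable [set: (Xspace R * Xspace R)%type] a J -> a \notin t ->
  (#|J| <= #|` t|)%N -> ~ asdim_obstr (Xspace R * Xspace R)%type (a |` t)%fset.
Proof.
move=> cJ at_ Jt [_]; apply.
pose f (j : J) := nth 0%N t (enum_rank j).
have fsize (j : J) : (enum_rank j < size t)%N.
  exact: leq_trans (ltn_ord _) Jt.
have ft j : f j \in t by exact: mem_nth.
have finj : injective f.
  move=> j j' /eqP; rewrite /f nth_uniq ?fset_uniq // => /eqP e.
  by apply: enum_rank_inj; apply: val_inj.
(* Being [r]-disjoint for the maximum implies being [i]-disjoint for every [i] in [t]. *)
pose r := \max_(i <- t) i.
have fr j : (f j <= r)%N by exact: (leq_bigmax_seq (F := id)).
have [T [col [id [b H]]]] := cJ r.
have {}H z z' : col z = col z' -> _ := H z z' I I.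
pose idx z := if col z is Some j then f j else a.
have idx_inj z z' : idx z = idx z' -> col z = col z'.
  rewrite /idx; case: (col z) (col z') => [j|] [j'|] //.
  - by move/finj ->.
  - by move=> fa; rewrite -fa ft in at_.
  - by move=> fa; rewrite fa ft in at_.
pose piece z := [set z' | col z' = col z /\ id z' = id z].
exists (fun i => [set S | exists2 z, idx z = i & S = piece z]); split.
  move=> i _; split.
    exists b.+1%:R; first by rewrite ltr0n.
    move=> _ [z _ ->]; apply: ge_ereal_sup => _ [[z1 z2] [[c1 i1] [c2 i2]] <-].
    have [+ _] := H z1 z2 (etrans c1 (esym c2)).
    move=> /(_ (etrans i1 (esym i2))) zb.
    by rewrite lee_fin mdist_XX ler_nat leqW.
  move=> _ _ [z zi ->] [z' z'i ->] zz'.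
  have cz : col z = col z' by apply: idx_inj; rewrite zi.
  apply: le_ereal_inf_tmp => _ [[z1 z2] [[c1 i1] [c2 i2]] <-].
  have c12 : col z1 = col z2 by rewrite c1 c2.
  have d12 : ((if col z1 is Some _ then r else a) <= XXdist z1 z2)%N.
    apply: (H z1 z2 c12).2 => e; apply: zz'.
    by rewrite /piece cz -i1 e i2.
  rewrite lee_fin mdist_XX ler_nat (leq_trans _ d12) //.
  by rewrite -zi /idx -c1; case: (col z1).
apply/seteqP; split=> // z _; exists (piece z) => //.
exists (idx z); last by exists z.
by rewrite /= !inE /idx; case: (col z) => [j|]; rewrite ?ft ?eqxx ?orbT.
Qed.

Theorem proposition4p2 (R : realType) :
  trasdim_eq (Xspace R * Xspace R)%type omega.
Proof.
apply: Ord_eq_omega => [a|]; last exact: asdim_obstr_XX.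
(* With [L := a], the bound [#|J|] is fixed by [a] before [t] is given. *)
have [J cJ] := @coverable_all R a a (leqnn a).
exists #|J| => t [_ [Mat at_]]; rewrite leqNgt; apply/negP => /ltnW Jt.
exact: coverable_covers cJ at_ Jt Mat.
Qed.
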